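(* Let $D\subseteq\mathbb{C}^n$ be a bounded domain and let $\Omega\subseteq\mathbb{C}^n$ be a bounded, balanced, convex domain. Put $\alpha=\mathrm{dist}(0,\partial\Omega)$ and $R=\tfrac12\,\mathrm{diam}(\Omega)$. Then for every $a\in D$ the following hold: (1) $S_D(a)\ \ge\ \dfrac{\alpha}{R}\,S_D^{\Omega}(a)$; (2) $S_D^{\Omega}(a)\ \ge\ \dfrac{\alpha}{R}\,S_D(a)$.
   Context: A domain $\Omega\subseteq\mathbb{C}^n$ is balanced if $\lambda z\in\Omega$ for every $z\in\Omega$ and every $\lambda\in\mathbb{C}$ with $|\lambda|\le 1$. Its Minkowski function is $h_\Omega(z)=\inf\{t>0:\ z/t\in\Omega\}$ for $z\in\mathbb{C}^n$, and for $0<r\le 1$ we put $\Omega(r)=\{z\in\mathbb{C}^n: h_\Omega(z)<r\}$. For domains $D,\Omega\subseteq\mathbb{C}^n$, $\mathcal{O}_u(D,\Omega)$ denotes the set of all injective holomorphic maps from $D$ into $\Omega$. $\mathbb{B}^n(0,r)$ is the open Euclidean ball of radius $r$ centered at the origin of $\mathbb{C}^n$, and $\mathbb{B}^n=\mathbb{B}^n(0,1)$. Distances and diameters are Euclidean. For a bounded domain $D\subseteq\mathbb{C}^n$ and $z\in D$, the squeezing function is $$S_D(z)=\sup\{r:\ \mathbb{B}^n(0,r)\subseteq f(D)\ \text{for some}\ f\in\mathcal{O}_u(D,\mathbb{B}^n)\ \text{with}\ f(z)=0\},$$ and for a bounded, balanced, convex domain $\Omega\subseteq\mathbb{C}^n$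 the generalized squeezing function is $$S_D^{\Omega}(z)=\sup\{r:\ \Omega(r)\subseteq f(D)\ \text{for some}\ f\in\mathcal{O}_u(D,\Omega)\ \text{with}\ f(z)=0\}.$$ *)

(* Defs.v *)
From HB Require Import structures.
From mathcomp Require Import all_boot all_order all_algebra.
From mathcomp Require Import complex.
From mathcomp Require Import all_classical all_reals all_analysis.

Set Implicit Arguments.
Unset Strict Implicit.
Unset Printing Implicit Defensive.

Import Order.TTheory GRing.Theory Num.Theory.
Import numFieldNormedType.Exports.

Local Open Scope classical_set_scope.
Local Open Scope ring_scope.

HB.instance Definition _ (R : rcfType) := PseudoMetric.copy R[i] R[i]^o.
HB.instance Definition _ (R : rcfType) := Pointed.copy R[i] R[i]^o.
HB.instance Definition _ (R : rcfType) := NormedModule.copy R[i] R[i]^o.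

(* C^n is the type of row vectors over [R[i]].  The library norm on it is the
   sup norm: it gives the usual topology, bounded sets and complex
   differentiability, but the metric quantities below use [enorm]. *)
Notation Cn R n := 'rV[R[i]]_n.

Section ComplexDomains.
Variables (R : realType) (n : nat).
Implicit Types (D Omega A : set (Cn R n)) (z w : Cn R n) (r t : R).

Definition enorm z : R :=
  Num.sqrt (\sum_(i < n) ComplexField.Normc.normc (z ord0 i) ^+ 2).

Definition eball z r : set (Cn R n) := [set w | enorm (w - z) < r].

Definition boundary A : set (Cn R n) := closure A `\` interior A.

Definition dist z A : R := inf [set enorm (z - w) | w in A].

Definition diam A : R := sup [set enorm (z - w) | z in A & w in A].

Definition domain D : Prop := [/\ D !=set0, open D & connected D].

Definition balanced Omega : Prop :=
  forall z (lambda : R[i]), Omega z -> `|lambda| <= 1 -> Omega (lambda *: z).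

(* The weights of [convex_set] are the [lambda : R[i]] with [0 <= lambda <= 1];
   in the partial order of [R[i]] these are exactly the real numbers of [0, 1],
   so this is ordinary (real) convexity. *)
Definition convex A : Prop := convex_set (A : set (convex_lmodType (Cn R n))).

Definition minkowski Omega z : R :=
  inf [set t | 0 < t /\ Omega ((real_complex R t)^-1 *: z)].

Definition sublevel Omega r : set (Cn R n) := [set z | minkowski Omega z < r].

(* [differentiable] is Frechet differentiability over the scalar field [R[i]];
   for open [D] the values of [f] outside [D] are irrelevant. *)
Definition holomorphic_on D (f : Cn R n -> Cn R n) : Prop :=
  forall z, D z -> differentiable f z.

Definition univalent D Omega : set (Cn R n -> Cn R n) :=
  [set f | [/\ holomorphic_on D f, set_inj D f & set_fun D Omega f]].

Definition squeezing D z : R :=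
  sup [set r | 0 < r /\ exists f,
    [/\ univalent D (eball 0 1) f, f z = 0 & eball 0 r `<=` f @` D]].

Definition gen_squeezing Omega D z : R :=
  sup [set r | 0 < r <= 1 /\ exists f,
    [/\ univalent D Omega f, f z = 0 & sublevel Omega r `<=` f @` D]].

End ComplexDomains.

(* Main.v *)
Require Import Defs.
From HB Require Import structures.
From mathcomp Require Import all_boot all_order all_algebra.
From mathcomp Require Import complex.
From mathcomp Require Import all_classical all_reals all_analysis.

Set Implicit Arguments.
Unset Strict Implicit.
Unset Printing Implicit Defensive.

Import Order.TTheory GRing.Theory Num.Theory.
Import numFieldNormedType.Exports.

Local Open Scope classical_set_scope.
Local Open Scope ring_scope.

(** The two domains are trapped between concentric balls: the ball of radius
    [alpha] lies in [Omega], because the segment from the origin to a point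
    outside [Omega] crosses the boundary ([ball_sub_domain]); and [Omega] lies
    in the open ball of radius [rho], because [z] and [- z] both belong to
    [Omega] ([balanced_sub_ball]).  Scaling these inclusions compares [r]-balls
    with the sublevel sets of the Minkowski function.

    Competitors for one squeezing function therefore become competitors for the
    other by composing with a homothety.  If [f] maps [D] into [Omega] and its
    image contains the [r]-sublevel set, then [f / rho] maps [D] into the unit
    ball and its image contains the ball of radius [alpha r / rho].  If [f]
    maps [D] into the unit ball and its image contains the [r]-ball, then
    [alpha f] maps [D] into [Omega] and its image contains the
    [alpha r / rho]-sublevel set.  Taking suprema ([mulr_sup_le]) gives both
    inequalities. *)

Section Squeezing.
Local Open Scope complex_scope.
Variables (R : realType) (n : nat).
Implicit Types (D Omega U : set (Cn R n)) (z w : Cn R n) (r s t c : R).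
Implicit Types (f : Cn R n -> Cn R n).

(** * The Euclidean norm and real dilations *)

Lemma enorm_ge0 z : 0 <= enorm z.
Proof. exact: sqrtr_ge0. Qed.

Lemma normc_ge0 (x : R[i]) : 0 <= Normc.normc x.
Proof. by case: x => x y; exact: sqrtr_ge0. Qed.

Lemma normc_real t : 0 <= t -> Normc.normc t%:C = t.
Proof. by move=> t0; rewrite /= expr0n addr0 sqrtr_sqr ger0_norm. Qed.

Lemma enormZ t z : 0 <= t -> enorm (t%:C *: z) = t * enorm z.
Proof.
move=> t0; rewrite /enorm -[in RHS](ger0_norm t0) -sqrtr_sqr -sqrtrM ?sqr_ge0//.
congr Num.sqrt; rewrite mulr_sumr; apply: eq_bigr => i _.
by rewrite mxE Normc.normcM normc_real// exprMn.
Qed.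

Lemma enormN z : enorm (- z) = enorm z.
Proof. by congr Num.sqrt; apply: eq_bigr => i _; rewrite mxE normcN. Qed.

Lemma unit_vector : (0 < n)%N -> exists z, enorm z = 1.
Proof.
move=> n0; exists (delta_mx ord0 (Ordinal n0)).
rewrite /enorm (bigD1 (Ordinal n0))//= big1 => [|i iN0]; rewrite !mxE eqxx/=.
  by rewrite expr1n expr0n/= !addr0 sqrtr1 expr1n sqrtr1.
by rewrite (negbTE iN0)/= expr0n addr0 sqrtr0 expr0n.
Qed.

Lemma dilation0 z : 0%:C *: z = 0 :> Cn R n.
Proof. by rewrite scale0r. Qed.

Lemma dilationA s t z : s%:C *: (t%:C *: z) = (s * t)%:C *: z.
Proof. by rewrite scalerA -rmorphM. Qed.

Lemma dilationK t : t != 0 -> cancel (fun z => t%:C *: z) (fun z => t^-1%:C *: z).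
Proof. by move=> t0 z; rewrite dilationA mulVf// scale1r. Qed.

Lemma dilationVK t : t != 0 -> cancel (fun z => t^-1%:C *: z) (fun z => t%:C *: z).
Proof. by move=> t0 z; rewrite dilationA mulfV// scale1r. Qed.

(** The geometric arguments below probe neighbourhoods only along real lines
    through the origin, so continuity of the scaling is put in this form. *)
Lemma near_dilation U s z : nbhs (s%:C *: z) U ->
  exists2 e, 0 < e & forall t, `|t - s| < e -> U (t%:C *: z).
Proof.
move=> /(@scalel_continuous _ _ z s%:C) /nbhs_ballP[[e b]] /=.
rewrite ltcE /= => /andP[/eqP -> e0] sU.
exists e => // t ts; apply: sU.
rewrite -ball_normE /ball_ mksetE -rmorphB normc_def /=.
by rewrite expr0n addr0 sqrtr_sqr ltcR distrC.
Qed.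

Lemma coord_le_mx_norm (K : numFieldType) p q (x : 'M[K]_(p, q)) i j :
  `|x i j| <= `|x|.
Proof.
rewrite [leRHS]mx_normE -[leLHS]nngE num_le.
exact: (le_bigmax _ (fun ij => `|x ij.1 ij.2|%:nng) (i, j)).
Qed.

Lemma bounded_enormB Omega : bounded_set Omega ->
  exists M, forall z w, Omega z -> Omega w -> enorm (z - w) <= M.
Proof.
move=> [[a b]] [Mreal] bM.
have [K K0 OK] : exists2 K, 0 <= K & forall z, Omega z -> `|z| <= K%:C.
  exists (`|a| + 1) => [|z Oz]; first by rewrite addr_ge0.
  apply: bM => //.
  move: Mreal; rewrite realE !lecE /= => Mreal.
  have /eqP -> : b == 0 by case/orP: Mreal => /andP[] // /eqP ->.
  by rewrite ltcE /= eqxx /= (le_lt_trans (ler_norm _))// ltrDl.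
exists (Num.sqrt (\sum_(i < n) (K + K) ^+ 2)) => z w Oz Ow.
rewrite ler_wsqrtr//; apply: ler_sum => i _.
rewrite lerXn2r ?nnegrE ?normc_ge0 ?addr_ge0//.
rewrite -lecR; apply: le_trans (coord_le_mx_norm (z - w) ord0 i) _.
apply: (le_trans (ler_normB _ _)); rewrite rmorphD/= lerD//; exact: OK.
Qed.

(** * A balanced domain between two balls *)

Lemma balanced0 Omega : Omega !=set0 -> balanced Omega -> Omega 0.
Proof.
by move=> [z Oz] /(_ z 0 Oz); rewrite scale0r normr0; apply.
Qed.

Lemma balancedN Omega z : balanced Omega -> Omega z -> Omega (- z).
Proof. by move=> bO Oz; rewrite -scaleN1r; apply: bO => //; rewrite normrN1. Qed.

Lemma dist0_ge0 (A : set (Cn R n)) : 0 <= dist 0 A.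
Proof.
rewrite /dist; have [->|A0] := eqVneq A set0; first by rewrite image_set0 inf0.
apply: lb_le_inf => [|_ [w _ <-]]; last exact: enorm_ge0.
by move/set0P : A0 => [w Aw]; exists (enorm (0 - w)), w.
Qed.

(** If [w] is outside [Omega], let [s] be the supremum of the [t] in [0, 1] with
    [t w] in [Omega]. Then [s w] is a limit of points of [Omega], and it is not
    in [Omega], since openness would allow a larger [t]; so it is a boundary
    point, of norm at most [enorm w]. *)
Lemma ball_sub_domain Omega : open Omega -> Omega 0 ->
  eball 0 (dist 0 (boundary Omega)) `<=` Omega.
Proof.
move=> oO O0 w; rewrite /eball /= subr0 => wd; apply: contrapT => Ow.
pose S := [set t | 0 <= t <= 1 /\ Omega (t%:C *: w)].
have S0 : S 0 by rewrite /S /= lexx ler01 dilation0.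
have hS : has_sup S by split; [exists 0|exists 1 => t [/andP[]]].
set s := sup S.
have s0 : 0 <= s by exact: (sup_upper_bound hS).
have s1 : s <= 1 by apply: ge_sup; [exists 0|move=> t [/andP[]]].
have NOs : ~ Omega (s%:C *: w).
  move=> Os; have [e e0 He] := near_dilation (open_nbhs_nbhs (conj oO Os)).
  have s_lt1 : s < 1.
    rewrite lt_neqAle s1 andbT; apply/eqP => s1E.
    by apply: Ow; move: Os; rewrite s1E scale1r.
  pose t := Num.min 1 (s + e / 2).
  have st : s < t by rewrite lt_min s_lt1 ltrDl divr_gt0.
  have : S t.
    split; first by rewrite (le_trans s0 (ltW st)) ge_min lexx.
    apply: He; rewrite gtr0_norm ?subr_gt0// ltrBlDl gt_min ltrD2l.
    by rewrite ltr_pdivrMr// ltr_pMr// ltr1n orbT.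
  by move/(sup_upper_bound hS); rewrite leNgt st.
suff bs : boundary Omega (s%:C *: w).
  suff : dist 0 (boundary Omega) <= enorm w by rewrite leNgt wd.
  apply: (@le_trans _ _ (enorm (0 - s%:C *: w))).
    apply: ge_inf; last by exists (s%:C *: w).
    by exists 0 => _ [v _ <-]; exact: enorm_ge0.
  by rewrite sub0r enormN enormZ// ler_piMl// enorm_ge0.
split; last by move=> /interior_subset.
move=> U /near_dilation[e e0 He].
have [t St ts] := sup_adherent e0 hS; exists (t%:C *: w); split; first by case: St.
have tls := sup_upper_bound hS St.
by apply: He; rewrite ler0_norm ?subr_le0// opprB ltrBlDl -ltrBlDr.
Qed.

Lemma enorm_le_radius Omega z : bounded_set Omega -> balanced Omega ->
  Omega z -> enorm z <= diam Omega / 2.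
Proof.
move=> /bounded_enormB[M OM] bO Oz; rewrite ler_pdivlMr//.
apply: ub_le_sup; first by exists M => _ [x Ox] [y Oy] <-; exact: OM.
exists z => //; exists (- z); first exact: balancedN.
rewrite opprK mulrC -enormZ//; congr enorm.
by rewrite rmorphMn rmorph1 scaler_nat mulr2n.
Qed.

Lemma radius_gt0 Omega : (0 < n)%N -> open Omega -> Omega 0 ->
  bounded_set Omega -> balanced Omega -> 0 < diam Omega / 2.
Proof.
move=> /unit_vector[u u1] oO O0 bdO bO.
have : nbhs (0%:C *: u) Omega.
  by rewrite dilation0; exact: open_nbhs_nbhs (conj oO O0).
case/near_dilation => e e0 He.
have e20 : 0 < e / 2 by rewrite divr_gt0.
have /(enorm_le_radius bdO bO) : Omega ((e / 2)%:C *: u).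
  by apply: He; rewrite subr0 gtr0_norm// ltr_pdivrMr// ltr_pMr// ltr1n.
by rewrite (enormZ _ (ltW e20)) u1 mulr1; exact: lt_le_trans.
Qed.

(** Openness makes the inclusion strict: a point of [Omega] can be pushed
    slightly outwards. *)
Lemma balanced_sub_ball Omega : (0 < n)%N -> open Omega -> Omega 0 ->
  bounded_set Omega -> balanced Omega -> Omega `<=` eball 0 (diam Omega / 2).
Proof.
move=> n0 oO O0 bdO bO z Oz; rewrite /eball /= subr0.
have [z0|z_gt0] := leP (enorm z) 0; first
  exact: le_lt_trans z0 (radius_gt0 n0 oO O0 bdO bO).
have : nbhs (1%:C *: z) Omega.
  by rewrite scale1r; exact: open_nbhs_nbhs (conj oO Oz).
case/near_dilation => e e0 He.
have e20 : 0 < e / 2 by rewrite divr_gt0.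
have /(enorm_le_radius bdO bO) : Omega ((1 + e / 2)%:C *: z).
  apply: He; rewrite addrAC subrr add0r gtr0_norm//.
  by rewrite ltr_pdivrMr// ltr_pMr// ltr1n.
have t0 : 0 <= 1 + e / 2 by rewrite addr_ge0// ltW.
rewrite enormZ//; apply: lt_le_trans.
by rewrite ltr_pMl// ltrDl.
Qed.

Lemma inradius_le_radius Omega : (0 < n)%N -> open Omega -> Omega 0 ->
  bounded_set Omega -> balanced Omega ->
  dist 0 (boundary Omega) <= diam Omega / 2.
Proof.
move=> n0 oO O0 bdO bO; rewrite leNgt; apply/negP => lt_rd.
have [u u1] := unit_vector n0.
have r0 := radius_gt0 n0 oO O0 bdO bO.
have /(balanced_sub_ball n0 oO O0 bdO bO) : Omega ((diam Omega / 2)%:C *: u).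
  apply: (ball_sub_domain oO O0).
  by rewrite /eball /= subr0 (enormZ _ (ltW r0)) u1 mulr1.
by rewrite /eball /= subr0 (enormZ _ (ltW r0)) u1 mulr1 ltxx.
Qed.

(** An infimum over the empty set would be 0 by convention, which would put
    [z] in every sublevel set; this does not occur, because [Omega] contains a
    neighbourhood of the origin and so some dilate of [z]. *)
Lemma sublevelP Omega r z : open Omega -> Omega 0 ->
  sublevel Omega r z <-> exists t, [/\ 0 < t, t < r & Omega (t^-1%:C *: z)].
Proof.
move=> oO O0; split=> [|[t [t0 tr Oz]]]; last first.
  apply: le_lt_trans tr; apply: ge_inf; first by exists 0 => s [/ltW].
  by split=> //; rewrite -fmorphV.
case/inf_lt.
  have : nbhs (0%:C *: z) Omega.
    by rewrite dilation0; exact: open_nbhs_nbhs (conj oO O0).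
  case/near_dilation => e e0 He; exists (e / 2)^-1.
  have e20 : 0 < e / 2 by rewrite divr_gt0.
  split; rewrite ?invr_gt0//= -fmorphV invrK; apply: He.
  by rewrite subr0 gtr0_norm// ltr_pdivrMr// ltr_pMr// ltr1n.
by move=> t [t0 Oz] tr; exists t; split => //; rewrite fmorphV.
Qed.

(** * Competitors and suprema *)

Lemma univalent_dilation D (A B : set (Cn R n)) c f : c != 0 ->
  univalent D A f -> (forall z, A z -> B (c%:C *: z)) ->
  univalent D B (fun z => c%:C *: f z).
Proof.
move=> c0 [hf injf fDA] AB; split.
- by move=> z Dz; apply: differentiableZ; exact: hf.
- by move=> x y xD yD /(can_inj (dilationK c0)); exact: injf.
- by move=> z Dz; apply: AB; exact: fDA.
Qed.

Lemma image_dilation D (A B : set (Cn R n)) c f : c != 0 ->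
  A `<=` f @` D -> (forall z, B z -> A (c^-1%:C *: z)) ->
  B `<=` (fun z => c%:C *: f z) @` D.
Proof.
move=> c0 Af BA z /BA/Af[x Dx fxE]; exists x => //.
by rewrite fxE dilationVK.
Qed.

Lemma sup_ge0 (A : set R) : (forall x, A x -> 0 <= x) -> 0 <= sup A.
Proof.
move=> A_ge0; have [hA|/sup_out -> //] := pselect (has_sup A).
by have [[x Ax] _] := hA; exact: le_trans (A_ge0 _ Ax) (sup_upper_bound hA Ax).
Qed.

(** When [A] is empty or [c] is 0 the left side is 0, and the right side is
    nonnegative because the elements of [B] are. *)
Lemma mulr_sup_le (A B : set R) c : 0 <= c -> has_ubound B ->
  (forall x, B x -> 0 <= x) -> (forall x, 0 < c -> A x -> B (c * x)) ->
  c * sup A <= sup B.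
Proof.
move=> c_ge0 ubB B_ge0 AB; have supB_ge0 := sup_ge0 B_ge0.
move: c_ge0; rewrite le_eqVlt => /predU1P[<-|c0]; first by rewrite mul0r.
have [->|/set0P A0] := eqVneq A set0; first by rewrite sup0 mulr0.
rewrite -ler_pdivlMl//; apply: ge_sup => // x Ax.
by rewrite ler_pdivlMl//; apply: ub_le_sup => //; exact: AB.
Qed.

Lemma squeezing_radius_le1 D f r : (0 < n)%N -> univalent D (eball 0 1) f ->
  eball 0 r `<=` f @` D -> r <= 1.
Proof.
move=> /unit_vector[u u1] [_ _ fD] rf; rewrite leNgt; apply/negP => r1.
have [|x /fD] := rf u; first by rewrite /eball /= subr0 u1.
by move=> + fxE; rewrite fxE /eball /= subr0 u1 ltxx.
Qed.

End Squeezing.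

Theorem proposition2p1 (R : realType) (n : nat) (n_gt0 : (0 < n)%N)
    (D Omega : set (Cn R n))
    (D_domain : domain D) (D_bounded : bounded_set D)
    (Omega_domain : domain Omega) (Omega_bounded : bounded_set Omega)
    (Omega_balanced : balanced Omega) (Omega_convex : convex Omega)
    (alpha rho : R)
    (alphaE : alpha = dist 0 (boundary Omega)) (rhoE : rho = diam Omega / 2)
    (a : Cn R n) (aD : D a) :
  squeezing D a >= alpha / rho * gen_squeezing Omega D a /\
  gen_squeezing Omega D a >= alpha / rho * squeezing D a.
Proof.
case: Omega_domain => Omega_neq0 oO _.
have O0 : Omega 0 by exact: balanced0.
have rho_gt0 : 0 < rho by rewrite rhoE; exact: radius_gt0.
have alpha_ge0 : 0 <= alpha by rewrite alphaE; exact: dist0_ge0.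
have ballO z : enorm z < alpha -> Omega z.
  by move=> za; apply: ball_sub_domain => //; rewrite /eball /= subr0 -alphaE.
have Oball z : Omega z -> enorm z < rho.
  move=> /(balanced_sub_ball n_gt0 oO O0 Omega_bounded Omega_balanced).
  by rewrite /eball /= subr0 rhoE.
have alpha_le : alpha <= rho by rewrite alphaE rhoE; exact: inradius_le_radius.
have c_ge0 : 0 <= alpha / rho by rewrite divr_ge0 // ltW.
split; apply: mulr_sup_le => //.
- by exists 1 => r [_ [f [fu _]]]; exact: squeezing_radius_le1.
- by move=> r [/ltW].
- move=> r c_gt0 [/andP[r_gt0 r_le1] [f [fu fa rf]]]; split.
    by rewrite mulr_gt0.
  have rhoV : rho^-1 != 0 by rewrite invr_neq0 ?gt_eqF.
  exists (fun z => real_complex R rho^-1 *: f z); split.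
  + apply: univalent_dilation fu _ => // z /Oball zr.
    by rewrite /eball /= subr0 enormZ ?invr_ge0 1?ltW// mulrC ltr_pdivrMr ?mul1r.
  + by rewrite fa scaler0.
  + apply: image_dilation rf _ => // z; rewrite /eball /= subr0 invrK => zr.
    have alpha_gt0 : 0 < alpha by move: c_gt0; rewrite pmulr_lgt0 ?invr_gt0.
    (* A radius [t < r] strictly between [rho |z| / alpha] and [r] makes
       [rho z / t] lie in the ball of radius [alpha], hence in [Omega]. *)
    have : alpha^-1 * (rho * enorm z) < r.
      by rewrite ltr_pdivrMl// mulrC -ltr_pdivlMr// mulrAC.
    move=> /midf_lt[lt1 lt2]; apply/sublevelP => //.
    set t := (_ / 2) in lt1 lt2.
    have t_gt0 : 0 < t.
      apply: le_lt_trans lt1.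
      by rewrite !mulr_ge0 ?invr_ge0 ?enorm_ge0 ?ltW.
    exists t; split => //; apply: ballO.
    by rewrite !enormZ ?invr_ge0 1?ltW// ltr_pdivrMl// [ltRHS]mulrC -ltr_pdivrMl.
- by exists 1 => r [/andP[]].
- by move=> r [/andP[/ltW]].
- move=> r c_gt0 [r_gt0 [f [fu fa rf]]]; split.
    have c_le1 : alpha / rho <= 1 by rewrite ler_pdivrMr// mul1r.
    have r_le1 : r <= 1 := squeezing_radius_le1 n_gt0 fu rf.
    by rewrite mulr_gt0//= mulr_ile1// ltW.
  have alpha_gt0 : 0 < alpha by move: c_gt0; rewrite pmulr_lgt0 ?invr_gt0.
  have alpha_neq0 : alpha != 0 by rewrite gt_eqF.
  exists (fun z => real_complex R alpha *: f z); split.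
  + apply: univalent_dilation fu _ => // z; rewrite /eball /= subr0 => z1.
    by apply: ballO; rewrite enormZ// gtr_pMr.
  + by rewrite fa scaler0.
  + apply: image_dilation rf _ => // z /(sublevelP _ _ oO O0)[t [t_gt0 tr /Oball]].
    rewrite /eball /= subr0 !enormZ ?invr_ge0 1?ltW//.
    rewrite !ltr_pdivrMl// => /lt_trans; apply.
    by rewrite -ltr_pdivlMr// mulrAC.
Qed.
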